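(* Let $R=\mathbb{k}[x_1,\dots,x_d]$ be a polynomial ring over an infinite field $\mathbb{k}$ and $\mathfrak m=(x_1,\dots,x_d)$ the maximal homogeneous ideal of $R$. If $L$ is a lex-segment ideal of height $g\geqslant2$ generated in degree $\delta\geqslant2$, then $$L\,\mathfrak m^{d(\delta-2)+g-\delta+1}\subseteq\operatorname{core}(L).$$
   Context: Lex-segment ideal: a monomial ideal $L=\bigoplus_{i\geqslant 0}L_i$ of $R$ such that, for every $i$, $L_i$ is spanned by the $\dim_{\mathbb{k}}L_i$ largest monomials of degree $i$ in the lexicographic order with $x_1>x_2>\cdots>x_d$. ''Generated in degree $\delta$'' means generated by its elements of degree $\delta$, i.e. all minimal monomial generators have degree $\delta$. A subideal $J\subseteq L$ is a reduction of $L$ if $L^{m+1}=JL^m$ for $m\gg0$; $\operatorname{core}(L)$ is the intersection of all reductions of $L$. *)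

(* Defs.v *)
From HB Require Import structures.
From mathcomp Require Import all_boot all_order all_algebra.
From mathcomp Require Import boolp classical_sets cardinality.
From mathcomp Require Import multinomials.mpoly.

Set Implicit Arguments.
Unset Strict Implicit.
Unset Printing Implicit Defensive.

Import Order.TTheory GRing.Theory.

Local Open Scope classical_set_scope.
Local Open Scope ring_scope.

(* Ideals are Prop-valued sets, so that one can quantify over all ideals
   without assuming that membership is decidable. *)
Section Ideals.
Variable A : comNzRingType.
Implicit Types (I J L P G : set A).

Definition is_ideal I : Prop :=
  [/\ I 0, forall a b, I a -> I b -> I (a + b) & forall a b, I b -> I (a * b)].

Definition ideal_span G : set A := smallest is_ideal G.

Definition ideal_mul I J : set A := ideal_span [set a * b | a in I & b in J].

Definition ideal_exp I n : set A := iter n (ideal_mul I) setT.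

Definition is_prime_ideal P : Prop :=
  [/\ is_ideal P, ~ P 1 & forall a b, P (a * b) -> P a \/ P b].

(* There is a chain C 0 < C 1 < ... < C n = P of prime ideals. *)
Definition prime_height_ge P n : Prop :=
  exists C : nat -> set A,
    [/\ forall i, (i <= n)%N -> is_prime_ideal (C i),
        forall i, (i < n)%N -> C i `<` C i.+1
      & C n = P].

Definition has_prime_height P n : Prop :=
  prime_height_ge P n /\ ~ prime_height_ge P n.+1.

(* The height of I is the minimum of the heights of the primes containing I;
   in particular the unit ideal has no height. *)
Definition has_height I g : Prop :=
  (exists P, [/\ is_prime_ideal P, I `<=` P & has_prime_height P g]) /\
  (forall P, is_prime_ideal P -> I `<=` P -> prime_height_ge P g).

Definition is_reduction L J : Prop :=
  [/\ is_ideal J, J `<=` L &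
      exists N, forall m, (N <= m)%N ->
        ideal_exp L m.+1 = ideal_mul J (ideal_exp L m)].

Definition core L : set A := \bigcap_(J in is_reduction L) J.

End Ideals.

Section LinearSpan.
Variables (k : fieldType) (V : lmodType k).

Definition lin_span (s : seq V) : set V :=
  [set v | exists a : 'I_(size s) -> k, v = \sum_i a i *: s`_i].

Definition lin_indep (s : seq V) : Prop :=
  forall a : 'I_(size s) -> k, \sum_i a i *: s`_i = 0 -> forall i, a i = 0.

Definition has_dim (U : set V) (c : nat) : Prop :=
  exists s : seq V, [/\ size s = c, lin_indep s & U = lin_span s].

End LinearSpan.

Section Polynomials.
Variables (k : fieldType) (d : nat).
Implicit Type L : set {mpoly k[d]}.

Definition maximal_homogeneous_ideal : set {mpoly k[d]} :=
  ideal_span [set 'X_i | i in [set: 'I_d]].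

Definition monomial_ideal L : Prop :=
  exists M : set 'X_{1..d}, L = ideal_span [set 'X_[k, m] | m in M].

Definition graded_part L (i : nat) : set {mpoly k[d]} :=
  [set f | L f /\ f \is i.-homog].

Definition generated_in_degree L (delta : nat) : Prop :=
  L = ideal_span (graded_part L delta).

(* The monomials of degree i, listed from the largest to the smallest.  On
   monomials of equal degree the order <=%O of mpoly is the lexicographic order
   in which the variable of index 0 is the largest: see mpoly.ltmcP. *)
Definition lex_monomials (i : nat) : seq 'X_{1..d} :=
  sort (fun m m' => m' <= m)%O
    [seq m <- [seq bmnm b | b : 'X_{1..d < i.+1}] | mdeg m == i].

Definition lex_segment_ideal L : Prop :=
  monomial_ideal L /\
  forall i, exists2 c, has_dim (graded_part L i) c
    & graded_part L i = lin_span [seq 'X_[k, m] | m <- take c (lex_monomials i)].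

End Polynomials.

Arguments maximal_homogeneous_ideal : clear implicits.

(* Main.v *)
Require Import Defs.
From mathcomp Require Import all_boot all_order all_algebra.
From mathcomp Require Import zify.
From mathcomp Require Import boolp classical_sets cardinality.
From mathcomp Require Import multinomials.mpoly.

(* Let V be the set of monomials of degree delta in L, and let M_n be spanned by
   the monomials of L^n of degree at least n delta + N, where N is the exponent
   of the maximal ideal.  The theorem follows from M_1 = J M_0, and this is the
   case n = 1, i = 0 of the following statement: for finitely many suitable
   elements of J, the Koszul homology H_i of the graded module M vanishes
   wherever the coefficients have degree n >= 1 (M has regularity 0).

   As J is a reduction of L, every w in V acts nilpotently on this Koszul
   homology.  Hence if w is regular on M, the vanishing for M / wM implies the
   vanishing for M.  The vanishing is also stable under extensions, and it is
   clear for modules concentrated in degrees n <= 0.  One concludes by induction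
   on d + delta.  If x_1 divides all elements of V, it can be divided out.
   Otherwise w = x_1 x_d^(delta - 1) lies in V, and the monomials of M / wM are
   - those with exponent i < delta - 1 at x_d, which form the module of the
     elements of V free of x_d, with N - i in place of N;
   - those with exponent 0 at x_1 and at least delta - 1 at x_d, which form the
     module of the elements of V free of x_1, with N - delta + 1 in place of N.
   The inequality N >= (d - 1)(delta - 2) + g - 1 is inherited by all of these,
   since removing x_1 lowers the height by one. *)

Set Implicit Arguments.
Unset Strict Implicit.
Unset Printing Implicit Defensive.

Import Order.TTheory GRing.Theory.

Local Open Scope classical_set_scope.
Local Open Scope ring_scope.

(** * Koszul homology of filtered quotients *)

Section Koszul.
Variable A : comNzRingType.
Implicit Types (I J K : set A) (fs : seq A) (a f w : A).

(* The total Koszul module of [s] elements: [(x, y)] stands for [x + e /\ y],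
   where [e] is the basis vector of the first element. *)
Fixpoint koszul (s : nat) : lmodType A :=
  if s is t.+1 then (koszul t * koszul t)%type else A^o.

Fixpoint koszul_diff fs : koszul (size fs) -> koszul (size fs) :=
  match fs with
  | [::] => fun=> 0
  | f :: fs' => fun x => (koszul_diff x.1 + f *: x.2, - koszul_diff x.2)
  end.

Fixpoint koszul_in I (s : nat) : koszul s -> Prop :=
  match s with
  | 0 => fun x => I x
  | t.+1 => fun x => koszul_in I x.1 /\ koszul_in I x.2
  end.
Arguments koszul_in I {s} _.

Lemma koszul_in0 I s : is_ideal I -> koszul_in I (0 : koszul s).
Proof. by move=> [I0 _ _]; elim: s => [//|s IH]; split; apply: IH. Qed.

Lemma koszul_inD I s (x y : koszul s) :
  is_ideal I -> koszul_in I x -> koszul_in I y -> koszul_in I (x + y).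
Proof.
move=> [_ ID _]; elim: s x y => [|s IH] /= x y; first exact: ID.
by move=> [x1 x2] [y1 y2]; split; apply: IH.
Qed.

Lemma koszul_inZ I J s a (x : koszul s) :
  (forall b, I b -> J (a * b)) -> koszul_in I x -> koszul_in J (a *: x).
Proof.
move=> aI; elim: s x => [|s IH] /= x; first exact: aI.
by move=> [x1 x2]; split; apply: IH.
Qed.

Lemma koszul_inN I s (x : koszul s) :
  is_ideal I -> koszul_in I x -> koszul_in I (- x).
Proof.
by move=> [_ _ IM]; rewrite -scaleN1r; apply: koszul_inZ => b; apply: IM.
Qed.

Lemma koszul_inB I s (x y : koszul s) :
  is_ideal I -> koszul_in I x -> koszul_in I y -> koszul_in I (x - y).
Proof.
by move=> idI xI yI; apply: koszul_inD => //; apply: koszul_inN.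
Qed.

Lemma koszul_inS I J s (x : koszul s) :
  I `<=` J -> koszul_in I x -> koszul_in J x.
Proof.
move=> sII; elim: s x => [|s IH] /= x; first exact: sII.
by move=> [x1 x2]; split; apply: IH.
Qed.

Lemma koszul_in_split I J K w s (x : koszul s) :
  (forall a, I a -> exists b c, [/\ J b, K c & a = b + w * c]) ->
  koszul_in I x ->
  exists y z, [/\ koszul_in J y, koszul_in K z & x = y + w *: z].
Proof.
move=> spl; elim: s x => [|s IH] /=; first exact: spl.
move=> [x1 x2] /= [/IH[y1 [z1 [y1I z1I ->]]] /IH[y2 [z2 [y2I z2I ->]]]].
by exists (y1, y2), (z1, z2); split.
Qed.

Lemma koszul_in_join I J K w s (y z : koszul s) :
  (forall b c, J b -> K c -> I (b + w * c)) ->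
  koszul_in J y -> koszul_in K z -> koszul_in I (y + w *: z).
Proof.
move=> jn; elim: s y z => [|s IH] /= y z; first exact: jn.
by move=> [y1 y2] [z1 z2]; split; apply: IH.
Qed.

Lemma koszul_in_regular I J K w s (x : koszul s) :
  (forall a, I a -> J (w * a) -> K a) ->
  koszul_in I x -> koszul_in J (w *: x) -> koszul_in K x.
Proof.
move=> reg; elim: s x => [|s IH] /= x; first exact: reg.
by move=> [x1 x2] [wx1 wx2]; split; apply: IH.
Qed.

Lemma koszul_diff_linear fs : linear (@koszul_diff fs).
Proof.
elim: fs => [|f fs IH] /= a x y; first by rewrite scaler0 addr0.
congr (_, _) => /=.
  by rewrite IH !scalerDr !scalerA (mulrC f a) addrACA.
by rewrite IH opprD scalerN.
Qed.

Lemma koszul_diffD fs : {morph @koszul_diff fs : x y / x + y}.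
Proof. by move=> x y; have := koszul_diff_linear 1 x y; rewrite !scale1r. Qed.

Lemma koszul_diff0 fs : @koszul_diff fs 0 = 0.
Proof. by apply: (addrI (koszul_diff 0)); rewrite -koszul_diffD !addr0. Qed.

Lemma koszul_diffZ fs a : {morph @koszul_diff fs : x / a *: x}.
Proof.
by move=> x; have := koszul_diff_linear a x 0; rewrite koszul_diff0 !addr0.
Qed.

Lemma koszul_diffN fs : {morph @koszul_diff fs : x / - x}.
Proof. by move=> x; rewrite -scaleN1r koszul_diffZ scaleN1r. Qed.

Lemma koszul_diffB fs : {morph @koszul_diff fs : x y / x - y}.
Proof. by move=> x y; rewrite koszul_diffD koszul_diffN. Qed.

Lemma koszul_diffK fs (x : koszul (size fs)) : koszul_diff (koszul_diff x) = 0.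
Proof.
elim: fs x => [//|f fs IH] [x y] /=.
congr (_, _) => /=; last by rewrite koszul_diffN IH !oppr0.
by rewrite koszul_diffD koszul_diffZ IH scalerN add0r subrr.
Qed.

Lemma koszul_in_diff I J fs (x : koszul (size fs)) :
    is_ideal J -> (forall f a, f \in fs -> I a -> J (f * a)) ->
  koszul_in I x -> koszul_in J (koszul_diff x).
Proof.
move=> idJ; elim: fs x => [|f fs IH] /= x fI; first by case: idJ.
have fsI g a : g \in fs -> I a -> J (g * a).
  by move=> gfs; apply: fI; rewrite inE gfs orbT.
move=> [x1 x2]; split; last by apply: koszul_inN => //; apply: IH.
apply: koszul_inD => //; first exact: IH.
by apply: koszul_inZ x2 => b; apply: fI; rewrite mem_head.
Qed.

(** The homotopy is exterior multiplication by the basis vector of [f]: the differential is an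
    antiderivation sending that vector to [f]. So every element of [fs] kills Koszul homology. *)
Lemma koszul_homotopy fs f : f \in fs ->
  exists h : koszul (size fs) -> koszul (size fs),
    [/\ linear h, forall I x, is_ideal I -> koszul_in I x -> koszul_in I (h x)
      & forall x, koszul_diff (h x) + h (koszul_diff x) = f *: x].
Proof.
elim: fs => [//|g fs IH]; rewrite inE => /predU1P[->|/IH[h [hlin hin hK]]].
    exists (fun x => (0, x.1)); split => [a x y /=|I x idI /= [x1 x2]|[x y] /=].
  - by congr (_, _) => /=; rewrite scaler0 addr0.
  - by split=> //; apply: koszul_in0.
  by congr (_, _) => /=; rewrite ?koszul_diff0 ?add0r ?addr0 // addKr.
have hN x : h (- x) = - h x.
  have h0 : h 0 = 0 by have := hlin (-1) 0 0; rewrite !scaleN1r !oppr0 addr0 addNr.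
  by have := hlin (-1) x 0; rewrite !scaleN1r h0 !addr0.
have hDZ a x y : h (x + a *: y) = h x + a *: h y by rewrite addrC hlin addrC.
exists (fun x => (h x.1, - h x.2)).
split => [a [x1 x2] [y1 y2] /=|I x idI /= [x1 x2]|[x y] /=].
- by congr (_, _) => /=; rewrite hlin // opprD scalerN.
- by split; [apply: hin | apply: koszul_inN => //; apply: hin].
congr (_, _) => /=; last by rewrite koszul_diffN hN !opprK hK.
by rewrite hDZ scalerN addrACA addNr addr0 hK.
Qed.

Section Exactness.
Variable fs : seq A.
Implicit Types (U W : nat -> set A).

Definition filtered U : Prop :=
  (forall n, is_ideal (U n)) /\
  (forall n f a, f \in fs -> U n a -> U n.+1 (f * a)).

(* The graded quotient [U / W] has no Koszul homology with coefficients in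
   positive degrees; the differential raises the degree of the coefficients
   by one. *)
Definition koszul_exact U W : Prop :=
  forall n (c : koszul (size fs)),
    koszul_in (U n.+1) c -> koszul_in (W n.+2) (koszul_diff c) ->
    exists2 b, koszul_in (U n) b & koszul_in (W n.+1) (c - koszul_diff b).

Lemma koszul_exact_concentrated U W :
  (forall n, is_ideal (U n)) -> (forall n, U n.+1 `<=` W n.+1) ->
  koszul_exact U W.
Proof.
move=> idU UW n c cU _; exists 0; first exact: koszul_in0.
by rewrite koszul_diff0 subr0; apply: koszul_inS cU; apply: UW.
Qed.

(** [U] and [U'] differ only in degree 0, and enlarging [U 0] only adds boundaries. *)
Lemma koszul_exact_subset U U' W :
  (forall n, U' n `<=` U n) -> (forall n, U n.+1 `<=` U' n.+1) ->
  koszul_exact U' W -> koszul_exact U W.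
Proof.
move=> U'U UU' ex n c cU dc.
have [b bU' cb] := ex n c (koszul_inS (UU' _) cU) dc.
by exists b => //; apply: koszul_inS bU'; apply: U'U.
Qed.

(** A cycle modulo [W] is also one modulo [V]. Subtracting a boundary brings it into [V], where it
    is still a cycle modulo [W]. *)
Lemma koszul_exact_trans U V W :
  filtered U -> filtered V -> (forall n, V n `<=` U n) ->
  (forall n, W n.+1 `<=` V n.+1) ->
  koszul_exact U V -> koszul_exact V W -> koszul_exact U W.
Proof.
move=> [idU _] [idV fV] VU WV exUV exVW n c cU dc.
have [b bU cbV] := exUV n c cU (koszul_inS (WV _) dc).
have dcb : koszul_in (W n.+2) (koszul_diff (c - koszul_diff b)).
  by rewrite koszul_diffB koszul_diffK subr0.
have [b' b'V cb'] := exVW n _ cbV dcb.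
exists (b + b'); last by rewrite koszul_diffD opprD addrA.
by apply: koszul_inD => //; apply: koszul_inS b'V; apply: VU.
Qed.

(* A power of [w] acts as zero on the Koszul homology of [U / W]. *)
Definition koszul_nilpotent U W w : Prop :=
  exists j, exists2 ps : seq (A * A),
    w ^+ j.+1 = \sum_(p <- ps) p.1 * p.2 &
    forall p, p \in ps ->
      [/\ p.2 \in fs, forall n a, U n a -> U (n + j)%N (p.1 * a)
        & forall n a, W n a -> W (n + j)%N (p.1 * a)].

(** Each summand [p.1 * p.2] of the power acts null-homotopically because [p.2] lies in [fs]; [b]
    adds up the homotopies applied to the [p.1 *: c]. *)
Lemma koszul_nilpotent_boundary U W w n (c : koszul (size fs)) :
    filtered U -> filtered W -> koszul_nilpotent U W w ->
    koszul_in (U n) c -> koszul_in (W n.+1) (koszul_diff c) ->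
  exists j b, koszul_in (U (n + j)%N) b /\
    koszul_in (W (n + j).+1) (w ^+ j.+1 *: c - koszul_diff b).
Proof.
move=> [idU _] [idW _] [j [ps wE psP]] cU dcW; exists j.
rewrite {}wE; elim: ps psP => [|[q f] ps IH] psP.
  exists 0; split; first exact: koszul_in0.
  by rewrite big_nil scale0r koszul_diff0 subr0; apply: koszul_in0.
have [p pps|b [bU cb]] := IH; first by apply: psP; rewrite inE pps orbT.
have [/= ffs qU qW] := psP _ (mem_head _ _).
have [h [hlin hin hK]] := koszul_homotopy ffs.
exists (h (q *: c) + b); split.
  apply: koszul_inD => //; apply: hin => //.
  by apply: koszul_inZ cU => a; apply: qU.
have qdc : koszul_in (W (n + j).+1) (h (q *: koszul_diff c)).
  by apply: hin => //; rewrite -addSn; apply: koszul_inZ dcW => a; apply: qW.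
rewrite big_cons /= scalerDl mulrC -scalerA -hK koszul_diffZ koszul_diffD.
have reorder (X Y S B : koszul (size fs)) : X + Y + S - (X + B) = Y + (S - B).
  by rewrite opprD addrACA (addrC X) addrK.
by rewrite reorder; apply: koszul_inD.
Qed.

(** [V] is [W + w U], and [w] is injective on [U / W] in positive degrees. By nilpotency some power
    of [w] turns a cycle into a boundary; vanishing for [U / V] then removes the factors [w] one at
    a time. *)
Lemma koszul_exact_regular U W V w :
    filtered U -> filtered W -> (forall n, W n `<=` U n) ->
    koszul_nilpotent U W w ->
    (forall n a, U n a -> U n.+1 (w * a)) ->
    (forall n a, W n a -> W n.+1 (w * a)) ->
    (forall n a, U n.+1 a -> W n.+2 (w * a) -> W n.+1 a) ->
    (forall n a, V n.+1 a <-> exists b c, [/\ W n.+1 b, U n c & a = b + w * c]) ->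
  koszul_exact U V -> koszul_exact U W.
Proof.
move=> fU fW WU nilw wU wW reg VE ex.
have [[idU fsU] [idW fsW]] := (fU, fW).
(* Write [D] for the differential. As [b] is a cycle modulo [V], it has the form [y + w z + D b']
   with [y] in [W]; then [w (c - D z)] lies in [W], and [w] cancels. *)
have descent n (c b : koszul (size fs)) :
    koszul_in (U n.+1) c -> koszul_in (W n.+2) (koszul_diff c) ->
    koszul_in (U n.+1) b -> koszul_in (W n.+2) (w *: c - koszul_diff b) ->
    exists2 b', koszul_in (U n) b' & koszul_in (W n.+1) (c - koszul_diff b').
  move=> cU dcW bU cbW.
  have dbV : koszul_in (V n.+2) (koszul_diff b).
    have -> : koszul_diff b = - (w *: c - koszul_diff b) + w *: c.
      by rewrite opprB subrK.
    apply: (koszul_in_join (J := W n.+2) _ _ cU); last exact: koszul_inN.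
    by move=> a a' Wa Ua'; apply/VE; exists a, a'.
  have [b' b'U bb'] := ex n b bU dbV.
  have [y [z [yW zU e]]] := koszul_in_split (fun a => (VE n a).1) bb'.
  exists z => //.
  apply: (@koszul_in_regular (U n.+1) (W n.+2) (W n.+1) w); first exact: reg.
    apply: koszul_inB => //; apply: koszul_in_diff zU => //; exact: fsU.
  have -> : w *: (c - koszul_diff z) = (w *: c - koszul_diff b) + koszul_diff y.
    have -> : b = y + w *: z + koszul_diff b'.
      by rewrite -e addrNK.
    rewrite !koszul_diffD koszul_diffK addr0 koszul_diffZ scalerBr opprD.
    by rewrite addrA [RHS]addrAC addrNK.
  by apply: koszul_inD => //; apply: koszul_in_diff yW => //; exact: fsW.
move=> n c cU dcW.
have wXU j : koszul_in (U (n + j).+1) (w ^+ j *: c).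
  elim: j => [|j IH]; first by rewrite addn0 scale1r.
  by rewrite addnS exprS -scalerA; apply: koszul_inZ IH => a; apply: wU.
have wXdW j : koszul_in (W (n + j).+2) (koszul_diff (w ^+ j *: c)).
  rewrite koszul_diffZ; elim: j => [|j IH]; first by rewrite addn0 scale1r.
  by rewrite addnS exprS -scalerA; apply: koszul_inZ IH => a; apply: wW.
have [j [b [bU cb]]] := koszul_nilpotent_boundary fU fW nilw cU dcW.
elim: j b bU cb => [|j IH] b.
  by rewrite addn0 expr1 => bU cb; apply: descent cb.
rewrite exprS -scalerA addSn => bU cb.
have [b' b'U cb'] := descent _ _ _ (wXU j.+1) (wXdW j.+1) bU cb.
by rewrite -addSnnS in b'U cb'; apply: IH cb'.
Qed.

End Exactness.
End Koszul.

(** * From Koszul vanishing to ideal membership *)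

Section KoszulGenerators.
Variable A : comNzRingType.

(** The element [a] is a cycle of exterior degree 0, hence a boundary since [W 1] is zero. The part
    of a boundary in exterior degree 0 is a combination of elements of [fs]. *)
Lemma koszul_exact_ideal (fs : seq A) (U W : nat -> set A) (J : set A) a :
  is_ideal J -> (forall f, f \in fs -> J f) -> is_ideal (U 1%N) ->
  is_ideal (W 2%N) -> (forall x, W 1%N x -> x = 0) ->
  koszul_exact fs U W -> U 1%N a -> J a.
Proof.
move=> idJ fsJ idU idW W1 ex Ua.
(* [iota] places [a] in exterior degree 0, and [aug] reads off that component. *)
pose fix iota s : koszul A s :=
  match s with 0 => a | t.+1 => (iota t, 0) end.
pose fix aug s : koszul A s -> A :=
  match s with 0 => fun x => x | t.+1 => fun x => aug t x.1 end.
have iotaU s : koszul_in (U 1%N) (iota s).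
  by elim: s => [//|s IH]; split=> //; apply: koszul_in0.
have aug_iota s : aug s (iota s) = a by elim: s.
have iota_cycle gs : koszul_diff (iota (size gs)) = 0 :> koszul A (size gs).
  elim: gs => [//|g gs IH] /=.
  by congr (_, _) => /=; rewrite ?koszul_diff0 ?oppr0 // IH scaler0 addr0.
have augB s (x y : koszul A s) : aug s (x - y) = aug s x - aug s y.
  by elim: s x y => [//|s IH] [x1 x2] [y1 y2] /=; apply: IH.
have augW s (x : koszul A s) : koszul_in (W 1%N) x -> aug s x = 0.
  by elim: s x => [|s IH] /= x; [exact: W1 | case=> /IH].
have [J0 JD JM] := idJ.
have aug_diff gs (x : koszul A (size gs)) :
    (forall f, f \in gs -> J f) -> J (aug _ (koszul_diff x)).
  elim: gs x => [//|g gs IH] /= [x y] /= gsJ.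
  have augD s (u v : koszul A s) : aug s (u + v) = aug s u + aug s v.
    by elim: s u v => [//|s IHs] [u1 u2] [v1 v2] /=; apply: IHs.
  have augZ s r (u : koszul A s) : aug s (r *: u) = r * aug s u.
    by elim: s u => [//|s IHs] [u1 u2] /=; apply: IHs.
  rewrite augD augZ; apply: JD.
    by apply: IH => f fgs; apply: gsJ; rewrite inE fgs orbT.
  by rewrite mulrC; apply: JM; apply: gsJ; rewrite mem_head.
have [|b _ /augW] := ex 0%N (iota (size fs)) (iotaU _).
  by rewrite iota_cycle; apply: koszul_in0.
rewrite augB aug_iota => /(canRL (subrK _)) ->.
by rewrite add0r; apply: aug_diff.
Qed.

End KoszulGenerators.

(** * Monomials *)

Section MonomialSpans.
Variables (k : fieldType) (d : nat).
Implicit Types (M : set 'X_{1..d}) (m v w z : 'X_{1..d}) (p q : {mpoly k[d]}).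

Definition mspan M : set {mpoly k[d]} :=
  [set p | forall m, m \in msupp p -> M m].

Lemma mspanS M M' : M `<=` M' -> mspan M `<=` mspan M'.
Proof. by move=> sMM p pM m /pM /sMM. Qed.

Lemma mspan0 M : mspan M 0.
Proof. by move=> m; rewrite msupp0. Qed.

Lemma mspanD M p q : mspan M p -> mspan M q -> mspan M (p + q).
Proof.
by move=> pM qM m /msuppD_le; rewrite mem_cat => /orP[/pM|/qM].
Qed.

Lemma mspanM M M' M'' p q :
  (forall m m', M m -> M' m' -> M'' (m + m')%MM) ->
  mspan M p -> mspan M' q -> mspan M'' (p * q).
Proof.
move=> MM pM qM m /msuppM_le /allpairsP[[m1 m2] /= [/pM Mm1 /qM Mm2 ->]].
exact: MM.
Qed.

Lemma mspanX M m : M m -> mspan M 'X_[m].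
Proof. by move=> Mm m'; rewrite msuppX inE => /eqP ->. Qed.

Definition upclosed M : Prop := forall m m', M m -> M (m' + m)%MM.

Lemma mspan_ideal M : upclosed M -> is_ideal (mspan M).
Proof.
move=> upM; split; [exact: mspan0 | by move=> p q; apply: mspanD|].
by move=> p q qM; apply: (@mspanM setT M) => // m m' _; apply: upM.
Qed.

Lemma mspan_split M M' w p :
  mspan [set m | M m \/ exists2 z, M' z & m = (w + z)%MM] p ->
  exists b c, [/\ mspan M b, mspan M' c & p = b + 'X_[w] * c].
Proof.
move=> pM; rewrite [p]mpolyE big_seq.
elim/big_ind: _ => [|p1 p2|m /pM [Mm|[z Mz ->]]].
- by exists 0, 0; rewrite mulr0 addr0; split=> //; apply: mspan0.
- move=> [b1 [c1 [b1M c1M ->]]] [b2 [c2 [b2M c2M ->]]].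
  exists (b1 + b2), (c1 + c2); rewrite mulrDr addrACA.
  by split=> //; apply: mspanD.
- exists (p@_m *: 'X_[m]), 0; rewrite mulr0 addr0.
  by split=> //; [move=> m' /msuppZ_le; apply: mspanX | apply: mspan0].
exists 0, (p@_(w + z) *: 'X_[z]); rewrite add0r -scalerAr mpolyXD.
by split=> //; [apply: mspan0 | move=> m' /msuppZ_le; apply: mspanX].
Qed.

End MonomialSpans.

(** * Products of monomial sets and lex segments *)

Section MonomialPowers.
Variable d : nat.
Implicit Types (M V Y : set 'X_{1..d}) (m v w z y r : 'X_{1..d}).
Implicit Types (i j l : 'I_d) (a b n N : nat).

Lemma addmCA : left_commutative (@mnm_add d).
Proof. by move=> m v w; rewrite !addmA (addmC m). Qed.

Lemma mnm_split i m : (0 < m i)%N -> exists r, m = (U_(i) + r)%MM.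
Proof.
move=> mi; exists (m - U_(i))%MM; rewrite addmC submK //.
by rewrite lep1mP -lt0n.
Qed.

Definition within a b : set 'X_{1..d} :=
  [set m | forall i, (0 < m i)%N -> (a <= i < b)%N].

Lemma withinD a b m m' : within a b (m + m')%MM <-> within a b m /\ within a b m'.
Proof.
split=> [mm|[mab m'ab] i]; last first.
  by rewrite mnmDE addn_gt0 => /orP[/mab|/m'ab].
by split=> i ?; apply: mm; rewrite mnmDE; lia.
Qed.

Lemma within_mulU a b i n : (a <= i < b)%N -> within a b (U_(i) *+ n)%MM.
Proof.
by move=> iab j; rewrite mulmnE mnm1E; case: eqP => [<-|_] /=; rewrite ?mul0n // => _.
Qed.

Lemma within_narrow_r a l m : within a l.+1 m -> m l = 0%N -> within a l m.
Proof.
move=> mal ml i mi; have := mal i mi.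
have il : i <> l by move=> e; rewrite e ml in mi.
by have : (i : nat) <> l by [move=> /val_inj; apply: il]; lia.
Qed.

Lemma within_narrow_l i b m : within i b m -> m i = 0%N -> within i.+1 b m.
Proof.
move=> mab mi j mj; have := mab j mj.
have ji : j <> i by move=> e; rewrite e mi in mj.
by have : (j : nat) <> i by [move=> /val_inj; apply: ji]; lia.
Qed.

(** The product set [V^n Y]. With [Y] everything, these are the monomials of the [n]-th power of the
    ideal generated by [V]; with [large_within] as [Y], a power of the maximal ideal is multiplied
    in. *)
Fixpoint mpow V Y n : set 'X_{1..d} :=
  if n is p.+1 then [set m | exists v z, [/\ V v, mpow V Y p z & m = (v + z)%MM]]
  else Y.

Lemma mpow_sub V V' Y Y' n :
  V `<=` V' -> Y `<=` Y' -> mpow V Y n `<=` mpow V' Y' n.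
Proof.
move=> VV YY; elim: n => [//|n IH] m [v [z [Vv /IH Mz ->]]].
by exists v, z; split=> //; apply: VV.
Qed.

Lemma mpow_add V Y Y' n z y :
  (forall x, Y x -> Y' (y + x)%MM) -> mpow V Y n z -> mpow V Y' n (y + z)%MM.
Proof.
move=> yY; elim: n z => [|n IH] z /=; first exact: yY.
move=> [v [x [Vv /IH Mx ->]]]; exists v, (y + x)%MM.
by split=> //; rewrite addmCA.
Qed.

Lemma mpow_restrict V Y n z (P : set 'X_{1..d}) :
  (forall m m', P (m + m')%MM -> P m /\ P m') ->
  mpow V Y n z -> P z -> mpow (V `&` P) (Y `&` P) n z.
Proof.
move=> PD; elim: n z => [//|n IH] z [v [x [Vv Mx ->]]] /PD[Pv Px].
by exists v, x; split=> //; apply: IH.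
Qed.

Definition large_within a b N : set 'X_{1..d} :=
  within a b `&` [set y | (N <= mdeg y)%N].

Local Notation mp V a b N := (mpow V (large_within a b N)).

Lemma large_withinS a b a' b' N N' :
  (forall m, within a b m -> within a' b' m) ->
  (N' <= N)%N -> large_within a b N `<=` large_within a' b' N'.
Proof.
by move=> ww NN m [mab Nm]; split; [apply: ww | apply: leq_trans Nm].
Qed.

Lemma mpow_within V a b N n z :
  V `<=` within a b -> mp V a b N n z -> within a b z.
Proof.
move=> Vab; elim: n z => [|n IH] z /=; first by case.
by move=> [v [x [/Vab vab /IH xab ->]]]; apply/withinD.
Qed.

Lemma mpow_large_add V a b N N' n z y :
  within a b y -> (N' <= N + mdeg y)%N ->
  mp V a b N n z -> mp V a b N' n (y + z)%MM.
Proof.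
move=> yab NN; apply: mpow_add => x [xab Nx]; split; first exact/withinD.
by rewrite /= mdegD (leq_trans NN) // addnC leq_add2l.
Qed.

Lemma mdeg_gt0P m : (0 < mdeg m)%N -> exists i, (0 < m i)%N.
Proof.
rewrite lt0n mdeg_eq0 => m0; apply/existsP; apply: contra_neqT m0.
by move=> /existsPn m0; apply/mnmP => i; rewrite mnm0E; have := m0 i; lia.
Qed.

Lemma mpow_drop V a b N n z : mp V a b N.+1 n z ->
  exists i t, [/\ (a <= i < b)%N, mp V a b N n t & z = (U_(i) + t)%MM].
Proof.
elim: n z => [|n IH] z /=.
  move=> [zab Nz]; have [i zi] := mdeg_gt0P (leq_trans (ltn0Sn _) Nz).
  have [r zE] := mnm_split zi; exists i, r; split=> //; first exact: zab.
  rewrite zE in zab Nz; have [_ rab] := (withinD _ _ _ _).1 zab.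
  by split=> //; move: Nz; rewrite /= mdegD mdeg1.
move=> [v [x [Vv /IH[i [t [iab Mt ->]]] ->]]].
by exists i, (v + t)%MM; split=> //; [exists v, t | rewrite addmCA].
Qed.

(** If [x_l] occurs in a factor [v] but not in the remaining product, a variable [x_i] with [i < l]
    is taken from that product and replaces [x_l] in [v], which the exchange hypothesis allows. *)
Lemma mpow_dropU V a l N n z :
    (forall r i, V (U_(l) + r)%MM -> (a <= i < l)%N -> V (U_(i) + r)%MM) ->
  mp V a l.+1 N.+1 n (U_(l) + z)%MM -> mp V a l.+1 N n z.
Proof.
move=> Vst; elim: n z => [|n IH] z /=.
  move=> [/withinD[_ zab]]; rewrite /= mdegD mdeg1 => Nz.
  by split.
move=> [v [x [Vv Mx e]]].
have [xl|/mnm_split[t xE]] := posnP (x l); last first.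
  exists v, t; split=> //; first by apply: IH; rewrite -xE.
  by apply: (@addmI _ U_(l)%MM); rewrite e xE addmCA.
have vl : (0 < v l)%N.
  by have /mnmP/(_ l) := e; rewrite !mnmDE xl mnm1E eqxx; lia.
have [r vE] := mnm_split vl.
have [i [t [ial Mt xE]]] := mpow_drop Mx.
have il : (i < l)%N.
  have il : i <> l by move=> il; move: xl; rewrite xE il mnmDE mnm1E eqxx.
  by have : (i : nat) <> l by [move=> /val_inj; apply: il]; lia.
exists (U_(i) + r)%MM, t; split=> //.
  by apply: Vst; [rewrite -vE | lia].
by apply: (@addmI _ U_(l)%MM); rewrite e vE xE -!addmA; congr (_ + _)%MM; rewrite addmCA.
Qed.

Lemma mpow_dropUn V a l N n z c :
    (forall r i, V (U_(l) + r)%MM -> (a <= i < l)%N -> V (U_(i) + r)%MM) ->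
  mp V a l.+1 (N + c)%N n (U_(l) *+ c + z)%MM -> mp V a l.+1 N n z.
Proof.
move=> Vst; elim: c => [|c IH]; first by rewrite mulm0n add0m addn0.
by rewrite addnS mulmS -addmA => /(mpow_dropU Vst).
Qed.

(** The first variable cannot be exchanged for an earlier one, so a factor of [V] is given up: what
    remains of it joins the base. If only the base contains [x_i], a whole factor joins it. Either
    way [e] is gained in degree. *)
Lemma mpow_drop_first V i b N e n z :
    (forall v, V v -> mdeg v = e.+1) -> V `<=` within i b ->
  mp V i b N n.+1 (U_(i) + z)%MM -> mp V i b (N + e)%N n z.
Proof.
move=> Vdeg Vib; elim: n z => [|n IH] z [v [x [Vv Mx e1]]].
all: have [vi|/mnm_split[r vE]] := posnP (v i).
all: try have /mnm_split[t xE] : (0 < x i)%N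
  by have /mnmP/(_ i) := e1; rewrite !mnmDE vi mnm1E eqxx; lia.
- have -> : z = (v + t)%MM by apply: (@addmI _ U_(i)%MM); rewrite e1 xE addmCA.
  move: Mx; rewrite xE => -[/withinD[_ tib]] /=; rewrite mdegD mdeg1 => Nt.
  split; first by apply: (withinD _ _ _ _).2; split=> //; apply: Vib.
  by rewrite /= mdegD Vdeg //; lia.
- have -> : z = (r + x)%MM by apply: (@addmI _ U_(i)%MM); rewrite e1 vE addmA.
  have [_ rib] : within i b U_(i)%MM /\ within i b r.
    by apply/withinD; rewrite -vE; apply: Vib.
  apply: (mpow_large_add (n := 0)) Mx => //.
  by have := Vdeg _ Vv; rewrite vE mdegD mdeg1; lia.
- have -> : z = (v + t)%MM by apply: (@addmI _ U_(i)%MM); rewrite e1 xE addmCA.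
  by exists v, t; split=> //; apply: IH; rewrite -xE.
- have -> : z = (r + x)%MM by apply: (@addmI _ U_(i)%MM); rewrite e1 vE addmA.
  have [_ rib] : within i b U_(i)%MM /\ within i b r.
    by apply/withinD; rewrite -vE; apply: Vib.
  apply: (mpow_large_add (n := n.+1)) Mx => //.
  by have := Vdeg _ Vv; rewrite vE mdegD mdeg1; lia.
Qed.

Lemma mpow_strip V Y i n z :
  (forall v, V v -> (0 < v i)%N) ->
  mpow V Y n z <->
  exists2 t, mpow [set v | V (U_(i) + v)%MM] Y n t & z = (U_(i) *+ n + t)%MM.
Proof.
move=> Vi; elim: n z => [|n IH] z /=.
  by split=> [Yz|[t Yt ->]]; [exists z|]; rewrite ?mulm0n ?add0m.
split=> [[v [x [Vv /IH[t Mt ->] ->]]]|[_ [v [t [Vv Mt ->]]] ->]].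
  have [r vE] := mnm_split (Vi _ Vv); exists (r + t)%MM.
    by exists r, t; rewrite /= -vE.
  by rewrite vE mulmS -!addmA; congr (_ + _)%MM; rewrite addmCA.
exists (U_(i) + v)%MM, (U_(i) *+ n + t)%MM; split=> //; first by apply/IH; exists t.
by rewrite mulmS -!addmA; congr (_ + _)%MM; rewrite addmCA.
Qed.

(** [V] is a lex segment of degree [e] in the polynomial ring on the variables with indices in
    [[a, b)]; the last clause spells out that [m] is lexicographically larger than [v]. *)
Definition lex_initial a b e V : Prop :=
  [/\ forall v, V v -> mdeg v = e, V `<=` within a b
    & forall v m, V v -> within a b m -> mdeg m = e ->
        (exists2 i : 'I_d, forall j : 'I_d, (j < i)%N -> m j = v j & (v i < m i)%N) -> V m].

Lemma lex_initial_restrict_r a l e V :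
  lex_initial a l.+1 e V -> lex_initial a l e (V `&` [set v | v l = 0%N]).
Proof.
move=> [Vdeg Vab Vlex]; split=> [v [/Vdeg]//|v [/Vab vab vl]|].
  exact: within_narrow_r.
move=> v m [Vv _] mal mdegm vm; split.
  by apply: (Vlex v) => // i /mal; lia.
by apply/eqP; rewrite -leqn0 leqNgt; apply/negP => /mal; lia.
Qed.

Lemma lex_initial_restrict_l i b e V :
  lex_initial i b e V -> lex_initial i.+1 b e (V `&` [set v | v i = 0%N]).
Proof.
move=> [Vdeg Vab Vlex]; split=> [v [/Vdeg]//|v [/Vab vab vl]|].
  exact: within_narrow_l.
move=> v m [Vv _] mal mdegm vm; split.
  by apply: (Vlex v) => // j /mal; lia.
by apply/eqP; rewrite -leqn0 leqNgt; apply/negP => /mal; lia.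
Qed.

Lemma lex_initial_strip i b e V : (i < b)%N ->
  lex_initial i b e.+1 V -> lex_initial i b e [set v | V (U_(i) + v)%MM].
Proof.
move=> ib [Vdeg Vab Vlex]; split=> [v /Vdeg|v /Vab /withinD[]//|].
  by rewrite mdegD mdeg1 => -[].
move=> v m Vv mab mdegm [j vm mj]; apply: (Vlex _ _ Vv).
- by apply/withinD; split=> //; have := @within_mulU i b i 1; rewrite mulm1n leqnn ib; apply.
- by rewrite mdegD mdeg1 mdegm.
by exists j => [j' /vm|]; rewrite !mnmDE ?ltn_add2l // => ->.
Qed.

(** This is strong stability: trading the last variable for an earlier one raises a monomial
    lexicographically. *)
Lemma lex_initial_exchange a l e V r i :
  lex_initial a l.+1 e V -> V (U_(l) + r)%MM -> (a <= i < l)%N -> V (U_(i) + r)%MM.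
Proof.
move=> [Vdeg Vab Vlex] Vr ial; apply: (Vlex _ _ Vr).
- have [_ rab] := (withinD _ _ _ _).1 (Vab _ Vr); apply/withinD; split=> //.
  by have := @within_mulU a l.+1 i 1; rewrite mulm1n; apply; lia.
- by have := Vdeg _ Vr; rewrite !mdegD !mdeg1.
have neq (x y : 'I_d) : (x : nat) <> y -> (x == y) = false.
  by move=> xy; apply/eqP => e1; apply: xy; rewrite e1.
exists i => [j ji|]; rewrite !mnmDE !mnm1E ?eqxx !neq //; lia.
Qed.

Lemma lex_initial_above i b e V v m :
  lex_initial i b e V -> V v -> within i b m -> mdeg m = e ->
  (v i < m i)%N -> V m.
Proof.
move=> [Vdeg Vab Vlex] Vv mib mdegm vm; apply: (Vlex v) => //.
exists i => // j ji.
have zero x : within i b x -> x j = 0%N.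
  by move=> xib; apply/eqP; rewrite -leqn0 leqNgt; apply/negP => /xib; lia.
by rewrite !zero //; apply: Vab.
Qed.

Lemma lex_initial_pure i b e V v : (i < b)%N ->
  lex_initial i b e V -> V v -> V (U_(i) *+ e)%MM.
Proof.
move=> ib Vini Vv; have [Vdeg Vab _] := Vini.
have wU : within i b (U_(i) *+ e)%MM by apply: within_mulU; rewrite leqnn.
have dU : mdeg (U_(i) *+ e)%MM = e by rewrite mdegMn mdeg1 mul1n.
have Ui : (U_(i) *+ e)%MM i = e by rewrite mulmnE mnm1E eqxx mul1n.
have [vi|vi] := ltnP (v i) e.
  by apply: (lex_initial_above Vini Vv); rewrite // Ui.
suff -> : (U_(i) *+ e)%MM = v by [].
have /esym e1 : (v - U_(i) *+ e + U_(i) *+ e)%MM = v.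
  apply: submK; apply/mnm_lepP => j; rewrite mulmnE mnm1E.
  by case: eqP => [<-|_] /=; rewrite ?mul1n ?mul0n.
have /eqP : mdeg (v - U_(i) *+ e)%MM = 0%N.
  by have := Vdeg _ Vv; rewrite {1}e1 mdegD dU; lia.
by rewrite mdeg_eq0 => /eqP e0; rewrite e1 e0 add0m.
Qed.

End MonomialPowers.

(** * Vanishing for lex-segments *)

Section LexExactness.
Variables (k : fieldType) (d : nat) (fs : seq {mpoly k[d]}) (V0 : set 'X_{1..d}).
Implicit Types (V : set 'X_{1..d}) (U W : nat -> set 'X_{1..d}).
Implicit Types (m v w z y r : 'X_{1..d}) (a b n N : nat) (p q : {mpoly k[d]}).

(** In the application, [V0] generates [L] and [fs] consists of elements of the reduction [J]; the
    reduction property enters as the nilpotency hypothesis. *)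
Hypothesis fs_V0 : forall f, f \in fs -> mspan (mpow V0 setT 1) f.
Hypothesis V0_nilpotent : forall v, V0 v ->
  exists j, exists2 ps : seq ({mpoly k[d]} * {mpoly k[d]}),
    'X_[v] ^+ j.+1 = \sum_(p <- ps) p.1 * p.2 &
    forall p : {mpoly k[d]} * {mpoly k[d]}, p \in ps -> p.2 \in fs /\ mspan (mpow V0 setT j) p.1.

(** The spans of the [U n] form a graded module over the Rees algebra of the ideal generated by
    [V0]. *)
Definition stable U : Prop :=
  (forall n, upclosed (U n)) /\
  (forall n v m, V0 v -> U n m -> U n.+1 (v + m)%MM).

Lemma stable_mpow U n j m m' :
  stable U -> mpow V0 setT j m -> U n m' -> U (n + j)%N (m + m')%MM.
Proof.
move=> [upU shU]; elim: j m => [|j IH] m /=; first by rewrite addn0 => _; apply: upU.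
by move=> [v [x [Vv Mx ->]]] Um'; rewrite addnS -addmA; apply: shU => //; apply: IH.
Qed.

Lemma stable_mspan U n j p q :
  stable U -> mspan (mpow V0 setT j) p -> mspan (U n) q ->
  mspan (U (n + j)%N) (p * q).
Proof. by move=> stU; apply: mspanM => m m'; apply: stable_mpow. Qed.

Lemma stable_filtered U : stable U -> filtered fs (fun n => mspan (U n)).
Proof.
move=> stU; split=> [n|n f p /fs_V0 fV0 pU]; first by apply: mspan_ideal; case: stU.
by rewrite -addn1; apply: stable_mspan.
Qed.

Lemma stable_mulX U v n p :
  stable U -> V0 v -> mspan (U n) p -> mspan (U n.+1) ('X_[v] * p).
Proof.
move=> stU Vv; rewrite -addn1; apply: stable_mspan => //.
by apply: mspanX; exists v, 0%MM; rewrite addm0.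
Qed.

Definition mono_exact U W : Prop :=
  koszul_exact fs (fun n => mspan (U n)) (fun n => mspan (W n)).

Lemma mono_exact_trans U U' W : stable U -> stable U' ->
  (forall n, U' n `<=` U n) -> (forall n, W n.+1 `<=` U' n.+1) ->
  mono_exact U U' -> mono_exact U' W -> mono_exact U W.
Proof.
move=> stU stU' U'U WU'; apply: koszul_exact_trans; try exact: stable_filtered.
  by move=> n; apply: mspanS.
by move=> n; apply: mspanS.
Qed.

Lemma mono_exact_subset U U' W :
  (forall n, U' n `<=` U n) -> (forall n, U n.+1 `<=` U' n.+1) ->
  mono_exact U' W -> mono_exact U W.
Proof.
by move=> U'U UU'; apply: koszul_exact_subset => n; apply: mspanS.
Qed.

(** The monomials of [W + w U], with [w] in degree 1. Degree 0 is empty, so that a layer built on it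
    satisfies the exponent bound of [presents] there. *)
Definition quot_by U W w n : set 'X_{1..d} :=
  if n is p.+1 then [set m | W p.+1 m \/ exists2 z, U p z & m = (w + z)%MM]
  else set0.

Lemma stable_quot U W w : stable U -> stable W -> stable (quot_by U W w).
Proof.
move=> [upU shU] [upW shW]; split=> [[//|n] m m'|[//|n] v m Vv].
  move=> [Wm|[z Uz ->]]; [by left; apply: upW | right].
  by exists (m' + z)%MM; [apply: upU | rewrite addmCA].
move=> [Wm|[z Uz ->]]; [by left; apply: shW | right].
by exists (v + z)%MM; [apply: shU | rewrite addmCA].
Qed.

Lemma mono_exact_regular U W w : V0 w -> stable U -> stable W ->
  (forall n, W n `<=` U n) ->
  (forall n m, U n.+1 m -> W n.+2 (w + m)%MM -> W n.+1 m) ->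
  mono_exact U (quot_by U W w) -> mono_exact U W.
Proof.
move=> Vw stU stW WU reg; apply: (@koszul_exact_regular _ _ _ _ _ 'X_[w]).
- exact: stable_filtered.
- exact: stable_filtered.
- by move=> n; apply: mspanS.
- have [j [ps wE psP]] := V0_nilpotent Vw; exists j, ps => // p /psP[pfs pV0].
  by split=> // n q; apply: stable_mspan.
- by move=> n p; apply: stable_mulX.
- by move=> n p; apply: stable_mulX.
- move=> n p pU wpW m mp; apply: reg; first exact: pU.
  by apply: wpW; rewrite mulrC (perm_mem (msuppMX _ _)); apply/mapP; exists m.
move=> n p; split; first exact: mspan_split.
move=> [b [c [bW cU ->]]]; apply: mspanD; first by move=> m /bW; left.
move=> m; rewrite mulrC (perm_mem (msuppMX _ _)) => /mapP[z /cU Uz ->].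
by right; exists z => //; rewrite addmC.
Qed.

(** * Graded quotients with a monomial basis *)

Local Notation mp V a b N := (mpow V (large_within a b N)).

(* [U / W] has, in positive degrees, the monomials of [mp V a b N n] shifted
   by [alpha *+ n + beta] as a basis. *)
Definition presents U W V a b N (alpha beta : 'X_{1..d}) : Prop :=
  [/\ forall n m, U n.+1 m /\ ~ W n.+1 m <->
        exists2 z, mp V a b N n.+1 z & m = (z + alpha *+ n.+1 + beta)%MM,
      forall z, large_within a b N z -> U 0%N (z + beta)%MM
    & forall m i, U 0%N m -> (beta i <= m i)%N].

Lemma presents_diff U W V a b N alpha beta n z :
  presents U W V a b N alpha beta -> mp V a b N n.+1 z ->
  U n.+1 (z + alpha *+ n.+1 + beta)%MM /\ ~ W n.+1 (z + alpha *+ n.+1 + beta)%MM.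
Proof. by move=> [UWD _ _] Mz; apply/UWD; exists z. Qed.

Lemma presents_top U W V a b N alpha beta n z :
  presents U W V a b N alpha beta -> mp V a b N n z ->
  U n (z + alpha *+ n + beta)%MM.
Proof.
case: n => [[_ U0 _] Yz|n pr /(presents_diff pr)[]//].
by rewrite mulm0n addm0; apply: U0.
Qed.

(** Multiplication by [w + alpha] sends basis monomials to basis monomials, because [w] is a factor
    from [V]. *)
Lemma presents_regular U W V a b N alpha beta w n m :
  V w -> presents U W V a b N alpha beta ->
  U n.+1 m -> W n.+2 (w + alpha + m)%MM -> W n.+1 m.
Proof.
move=> Vw pr Um Wm; apply: contrapT => nWm; have [UWD _ _] := pr.
have [z Mz mE] := (UWD n m).1 (conj Um nWm).
have Mwz : mp V a b N n.+2 (w + z)%MM by exists w, z.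
have [_] := presents_diff pr Mwz; apply.
suff -> : (w + z + alpha *+ n.+2 + beta)%MM = (w + alpha + m)%MM by [].
by rewrite mE; apply/mnmP => i; rewrite !mnmDE !mulmnE; lia.
Qed.

(** A basis monomial vanishing modulo [w + alpha] has a basis monomial as cofactor in degree at
    least 2; in degree 1 only membership of the cofactor in [U 0] is known. *)
Lemma presents_quot U W V a b N alpha beta w n m :
  stable W -> V0 (w + alpha)%MM -> presents U W V a b N alpha beta ->
  U n.+1 m -> ~ W n.+1 m -> quot_by U W (w + alpha)%MM n.+1 m ->
  exists2 m', U n m' & m = (w + alpha + m')%MM /\
    forall s, n = s.+1 -> exists2 z, mp V a b N n z & m = (w + z + alpha *+ n.+1 + beta)%MM.
Proof.
move=> [_ shW] V0w [UWD _ _] Um nWm [//|[m' Um' mE]]; exists m' => //; split=> // s ns.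
subst n; have nWm' : ~ W s.+1 m'.
  by move=> Wm'; apply: nWm; rewrite mE; apply: shW.
have [z Mz m'E] := (UWD s m').1 (conj Um' nWm'); exists z => //.
by rewrite mE m'E; apply/mnmP => i; rewrite !mnmDE !mulmnE; lia.
Qed.

(** Here [V] consists of the monomial 1 alone, so every basis monomial is a multiple of [alpha], and
    the quotient by [alpha] is zero in positive degrees. *)
Lemma lex_exact_degree0 V a b N alpha beta U W :
  V 0%MM -> (forall v, V v -> mdeg v = 0%N) -> V0 alpha ->
  stable U -> stable W -> (forall n, W n `<=` U n) ->
  presents U W V a b N alpha beta -> mono_exact U W.
Proof.
move=> V00 Vdeg V0a stU stW WU pr.
apply: (mono_exact_regular V0a) => // [n m Um Wm|].
  by apply: (presents_regular V00 pr Um); rewrite add0m.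
apply: koszul_exact_concentrated => n; first by apply: mspan_ideal; case: stU.
apply: mspanS => m Um; have [Wm|nWm] := pselect (W n.+1 m); [by left | right].
have [UWD _ _] := pr; have [z [v [y [Vv My ->]]] mE] := (UWD n m).1 (conj Um nWm).
have v0 : v = 0%MM by apply/eqP; rewrite -mdeg_eq0 Vdeg.
exists (y + alpha *+ n + beta)%MM; first exact: presents_top pr My.
by rewrite mE v0; apply/mnmP => i; rewrite !mnmDE !mulmnE mnm0E; lia.
Qed.

Lemma presents_strip U W V (i : 'I_d) b N alpha beta :
  (forall v, V v -> (0 < v i)%N) -> presents U W V i b N alpha beta ->
  presents U W [set v | V (U_(i) + v)%MM] i b N (U_(i) + alpha)%MM beta.
Proof.
move=> Vi [UWD U0 U0beta]; split=> // n m; rewrite UWD.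
split=> [[z /(mpow_strip _ _ _ Vi)[s Ms ->] ->]|[s Ms ->]].
  by exists s => //; apply/mnmP => j; rewrite !mnmDE !mulmnE !mnmDE; lia.
exists (U_(i) *+ n.+1 + s)%MM; first by apply/(mpow_strip _ _ _ Vi); exists s.
by apply/mnmP => j; rewrite !mnmDE !mulmnE !mnmDE; lia.
Qed.

(* The filtration of [U / Q] by the exponent of [x_l]. *)
Definition layer U Q (l : 'I_d) c n : set 'X_{1..d} :=
  [set m | Q n m \/ (U n m /\ (c <= m l)%N)].

Lemma stable_layer U Q l c : stable U -> stable Q -> stable (layer U Q l c).
Proof.
move=> [upU shU] [upQ shQ]; split=> [n m m'|n v m Vv].
  move=> [Qm|[Um cm]]; [by left; apply: upQ | right].
  by split; [apply: upU | rewrite mnmDE (leq_trans cm) // leq_addl].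
move=> [Qm|[Um cm]]; [by left; apply: shQ | right].
by split; [apply: shU | rewrite mnmDE (leq_trans cm) // leq_addl].
Qed.

(** * The quotient by [x_i x_l^e], layer by layer in [x_l] *)

Section FirstAndLastVariable.
Variables (V : set 'X_{1..d}) (i l : 'I_d) (e N : nat) (alpha beta : 'X_{1..d}).
Variables (U W : nat -> set 'X_{1..d}).
Hypothesis il : (i < l)%N.
Hypothesis Vini : lex_initial i l.+1 e.+1 V.
Let w0 : 'X_{1..d} := (U_(i) + U_(l) *+ e)%MM.
Hypothesis Vw0 : V w0.
Hypothesis alpha0 : forall j : 'I_d, (i < j)%N -> alpha j = 0%N.
Hypothesis V0w : V0 (w0 + alpha)%MM.
Hypothesis stU : stable U.
Hypothesis stW : stable W.
Hypothesis WU : forall n, W n `<=` U n.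
Hypothesis pr : presents U W V i l.+1 N alpha beta.
Hypothesis eN : (e <= N)%N.

Let Q := quot_by U W (w0 + alpha)%MM.
Let L c := layer U Q l (c + beta l).

Let Vexch r (j : 'I_d) : V (U_(l) + r)%MM -> (i <= j < l)%N -> V (U_(j) + r)%MM.
Proof. exact: lex_initial_exchange Vini. Qed.

Let neq_il : (i == l) = false.
Proof. by apply/eqP => e1; move: il; rewrite e1 ltnn. Qed.

Let stQ : stable Q.
Proof. exact: stable_quot. Qed.

Let QU n : Q n `<=` U n.
Proof.
case: n => [//|n] m [/WU//|[z Uz ->]].
by case: stU => _; apply.
Qed.

Let split_l c z : (c <= z l)%N -> exists t, z = (U_(l) *+ c + t)%MM.
Proof.
elim: c z => [|c IH] z cz; first by exists z; rewrite mulm0n add0m.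
have [t zE] := IH z (ltnW cz).
have [r tE] : exists r, t = (U_(l) + r)%MM.
  by apply: mnm_split; move: cz; rewrite zE mnmDE mulmnE mnm1E eqxx; lia.
by exists r; rewrite zE tE mulmSr addmA.
Qed.

(** Since [alpha] does not involve [x_l], the layer holds the basis monomials with [z l = c];
    dividing by [x_l^c] lowers [N] by [c]. As [c < e], none of them vanishes modulo [w0]. *)
Lemma layer_presents c : (c < e)%N ->
  presents (L c) (L c.+1) (V `&` [set v | v l = 0%N]) i l (N - c) alpha
    (U_(l) *+ c + beta)%MM.
Proof.
move=> ce; have [UWD U0 U0beta] := pr; have [Vdeg Vab _] := Vini.
have cl t : (U_(l) *+ c + t)%MM l = (c + t l)%N.
  by rewrite mnmDE mulmnE mnm1E eqxx mul1n.
split=> [n m|z [zil Nz]|m j].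
- split=> [[Lm nLm]|[z Mz ->]].
    have [Um cm nQm] : [/\ U n.+1 m, (c + beta l <= m l)%N & ~ Q n.+1 m].
      have nQm : ~ Q n.+1 m by move=> Qm; apply: nLm; left.
      by case: Lm => // -[].
    have nWm : ~ W n.+1 m by move=> Wm; apply: nQm; left.
    have [z Mz mE] := (UWD n m).1 (conj Um nWm).
    have zl : z l = c.
      have : ~~ (c.+1 + beta l <= m l)%N.
        by apply/negP => cm'; apply: nLm; right.
      by move: cm; rewrite mE !mnmDE mulmnE alpha0 //; lia.
    have [t zE] := split_l (eq_leq (esym zl)).
    have tl : t l = 0%N by move: zl; rewrite zE cl; lia.
    exists t; last by rewrite mE zE; apply/mnmP => j; rewrite !mnmDE; lia.
    have Mt : mp V i l.+1 (N - c) n.+1 t.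
      by apply: (mpow_dropUn (c := c) Vexch); rewrite -zE subnK //; lia.
    have PD m1 m2 : (m1 + m2)%MM l = 0%N -> m1 l = 0%N /\ m2 l = 0%N.
      by rewrite mnmDE; lia.
    apply: mpow_sub (mpow_restrict (P := [set x | x l = 0%N]) PD Mt tl) => //.
    by move=> y [[yil Ny] y0]; split=> //; apply: within_narrow_r.
  have Mz' : mp V i l.+1 N n.+1 (U_(l) *+ c + z)%MM.
    apply: (@mpow_large_add _ _ _ _ (N - c)).
    - by apply: within_mulU; lia.
    - by rewrite mdegMn mdeg1; lia.
    apply: mpow_sub Mz => [v []//|]; apply: large_withinS => // x xil j /xil; lia.
  have zl : z l = 0%N.
    apply/eqP; rewrite -leqn0 leqNgt; apply/negP.
    have zil : within i l z.
      by apply: mpow_within Mz => v [/Vab vab vl]; apply: within_narrow_r.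
    by move=> /zil; lia.
  have mE : (z + alpha *+ n.+1 + (U_(l) *+ c + beta))%MM =
            (U_(l) *+ c + z + alpha *+ n.+1 + beta)%MM.
    by apply/mnmP => j; rewrite !mnmDE; lia.
  have [Um nWm] := presents_diff pr Mz'; rewrite -mE in Um nWm.
  split.
    by right; split=> //; rewrite mE !mnmDE mulmnE mnm1E eqxx; lia.
  have ml : (z + alpha *+ n.+1 + (U_(l) *+ c + beta))%MM l = (c + beta l)%N.
    by rewrite !mnmDE !mulmnE mnm1E eqxx zl alpha0 //; lia.
  case; last by rewrite ml; lia.
  (* A multiple of [w0] would have exponent at least [e + beta l] at [l]; in degree 1 this rests on
     the exponent bound for [U 0]. *)
  move=> /(presents_quot stW V0w pr Um nWm)[m' Um' [mE' mp']].
  case: n Um nWm Mz Mz' mE ml Um' mE' mp' => [|n] Um nWm Mz Mz' mE ml Um' mE' mp'.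
    have := U0beta m' l Um'.
    by move: ml; rewrite mE' /w0 !mnmDE !mulmnE !mnm1E eqxx neq_il; lia.
  have [//|x _ mx] := mp' n.
  by move: ml; rewrite mx /w0 !mnmDE !mulmnE !mnm1E eqxx neq_il; lia.
- right; split; last by rewrite !mnmDE mulmnE mnm1E eqxx; lia.
  rewrite addmA (addmC z); apply: U0; split.
    apply: (withinD _ _ _ _).2; split; first by apply: within_mulU; lia.
    by move=> j /zil; lia.
  by move: Nz; rewrite /= mdegD mdegMn mdeg1; lia.
case=> [//|[Um cm]]; rewrite mnmDE mulmnE mnm1E; case: eqP => [<-|_].
  by rewrite mul1n.
by rewrite mul0n; apply: U0beta.
Qed.

(** Among the basis monomials with [z l] at least [e], those vanishing modulo [w0] are exactly the
    ones with [z] divisible by [x_i]. *)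
Lemma last_layer_presents :
  presents (L e) Q (V `&` [set v | v i = 0%N]) i.+1 l.+1 (N - e) alpha
    (U_(l) *+ e + beta)%MM.
Proof.
have [UWD U0 U0beta] := pr; have [Vdeg Vab _] := Vini.
split=> [n m|z [zil Nz]|m j].
- split=> [[Lm nQm]|[z Mz ->]].
    have [Um em] : U n.+1 m /\ (e + beta l <= m l)%N by case: Lm.
    have nWm : ~ W n.+1 m by move=> Wm; apply: nQm; left.
    have [z Mz mE] := (UWD n m).1 (conj Um nWm).
    have zl : (e <= z l)%N by move: em; rewrite mE !mnmDE mulmnE alpha0 //; lia.
    have [t zE] := split_l zl.
    have zi : z i = 0%N.
      apply/eqP; rewrite -leqn0 leqNgt; apply/negP => zi; apply: nQm; right.
      have [s tE] : exists s, t = (U_(i) + s)%MM.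
        apply: mnm_split; move: zi; rewrite zE mnmDE mulmnE mnm1E.
        by rewrite eq_sym neq_il.
      (* Cancelling [x_i] gives up one factor of [V] but gains [e] in degree, which pays for
         cancelling [x_l^e]. *)
      have Ms : mp V i l.+1 N n s.
        apply: (mpow_dropUn (c := e) Vexch); apply: mpow_drop_first Vdeg Vab _.
        by rewrite addmCA -tE -zE.
      exists (s + alpha *+ n + beta)%MM; first exact: presents_top pr Ms.
      by rewrite mE zE tE /w0; apply/mnmP => j; rewrite !mnmDE !mulmnE; lia.
    have ti : t i = 0%N by move: zi; rewrite zE mnmDE; lia.
    exists t; last by rewrite mE zE; apply/mnmP => j; rewrite !mnmDE; lia.
    have Mt : mp V i l.+1 (N - e) n.+1 t.
      by apply: (mpow_dropUn (c := e) Vexch); rewrite -zE subnK.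
    have PD m1 m2 : (m1 + m2)%MM i = 0%N -> m1 i = 0%N /\ m2 i = 0%N.
      by rewrite mnmDE; lia.
    apply: mpow_sub (mpow_restrict (P := [set x | x i = 0%N]) PD Mt ti) => //.
    by move=> y [[yil Ny] y0]; split=> //; apply: within_narrow_l.
  have Mz' : mp V i l.+1 N n.+1 (U_(l) *+ e + z)%MM.
    apply: (@mpow_large_add _ _ _ _ (N - e)).
    - by apply: within_mulU; lia.
    - by rewrite mdegMn mdeg1; lia.
    apply: mpow_sub Mz => [v []//|]; apply: large_withinS => // x xil j /xil; lia.
  have zi : z i = 0%N.
    apply/eqP; rewrite -leqn0 leqNgt; apply/negP.
    have zil : within i.+1 l.+1 z.
      by apply: mpow_within Mz => v [/Vab vab vl]; apply: within_narrow_l.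
    by move=> /zil; lia.
  have mE : (z + alpha *+ n.+1 + (U_(l) *+ e + beta))%MM =
            (U_(l) *+ e + z + alpha *+ n.+1 + beta)%MM.
    by apply/mnmP => j; rewrite !mnmDE; lia.
  have [Um nWm] := presents_diff pr Mz'; rewrite -mE in Um nWm.
  split.
    by right; split=> //; rewrite mE !mnmDE mulmnE mnm1E eqxx; lia.
  have mi : (z + alpha *+ n.+1 + (U_(l) *+ e + beta))%MM i = (alpha i * n.+1 + beta i)%N.
    by rewrite !mnmDE !mulmnE mnm1E eq_sym neq_il zi; lia.
  (* A multiple of [w0] would have an exponent at [i] exceeding the value in [mi]. *)
  move=> /(presents_quot stW V0w pr Um nWm)[m' Um' [mE' mp']].
  case: n Um nWm Mz Mz' mE mi Um' mE' mp' => [|n] Um nWm Mz Mz' mE mi Um' mE' mp'.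
    have := U0beta m' i Um'.
    by move: mi; rewrite mE' /w0 !mnmDE !mulmnE !mnm1E eqxx; lia.
  have [//|x _ mx] := mp' n.
  by move: mi; rewrite mx mnmDE mnmDE mulmnE /w0 !mnmDE !mnm1E eqxx; lia.
- right; split; last by rewrite !mnmDE mulmnE mnm1E eqxx; lia.
  rewrite addmA (addmC z); apply: U0; split.
    apply: (withinD _ _ _ _).2; split; first by apply: within_mulU; lia.
    by move=> j /zil; lia.
  by move: Nz; rewrite /= mdegD mdegMn mdeg1; lia.
case=> [//|[Um cm]]; rewrite mnmDE mulmnE mnm1E; case: eqP => [<-|_].
  by rewrite mul1n.
by rewrite mul0n; apply: U0beta.
Qed.

Lemma lex_exact_layers :
  (forall c, (c < e)%N -> mono_exact (L c) (L c.+1)) -> mono_exact (L e) Q ->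
  mono_exact U W.
Proof.
move=> exL exQ; have [UWD U0 U0beta] := pr.
have stL c : stable (L c) by apply: stable_layer.
have QL c n : Q n `<=` L c n by move=> m; left.
have LU c n : L c n `<=` U n by move=> m [/QU|[]].
have exLQ c : (c <= e)%N -> mono_exact (L c) Q.
  move=> ce; rewrite -(subKn ce).
  elim: (e - c)%N => [|t IH]; first by rewrite subn0.
  have [te|te] := ltnP t e; last by rewrite (_ : e - t.+1 = e - t)%N //; lia.
  apply: (mono_exact_trans (U' := L (e - t)%N)) => //.
    move=> n m [Qm|[Um cm]]; [by left | right; split=> //].
    by apply: leq_trans cm; rewrite leq_add2r; lia.
  by rewrite -(subnSK te); apply: exL; lia.
apply: (mono_exact_regular V0w) => // [n m|]; first exact: presents_regular pr.
(* Every basis monomial is divisible by [beta], so [L 0] agrees with [U] in positive degrees. *)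
apply: (mono_exact_subset (U' := L 0%N)) (exLQ _ (leq0n e)) => // n m Um.
have [Wm|nWm] := pselect (W n.+1 m); first by do 2 left.
have [z _ mE] := (UWD n m).1 (conj Um nWm).
by right; split=> //; rewrite mE !mnmDE; lia.
Qed.

End FirstAndLastVariable.

(* Without truncated subtraction, the bound on [N] reads
   [N >= (b - a - 1) * (e - 2) + g - 1]. *)
Lemma lex_exact t a b e V N g (alpha beta v0 : 'X_{1..d}) U W :
  (b - a + e <= t)%N -> (a < b <= d)%N -> lex_initial a b e V -> V v0 ->
  (forall j : 'I_d, (a < j)%N -> alpha j = 0%N) ->
  (forall v, V v -> V0 (v + alpha)%MM) ->
  (forall i : 'I_d, (a <= i < b)%N -> V (U_(i) *+ e)%MM -> (i < a + g)%N) ->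
  ((b - a).-1 * e + g < N + 2 * (b - a))%N ->
  stable U -> stable W -> (forall n, W n `<=` U n) ->
  presents U W V a b N alpha beta ->
  mono_exact U W.
Proof.
elim: t a b e V N g alpha beta v0 U W => [|t IH] a b e V N g alpha beta v0 U W.
  by lia.
move=> lt ab Vini Vv0 alpha0 V0alpha pureV bound stU stW WU pr.
have [Vdeg Vab Vlex] := Vini.
have [e0|e_gt0] := posnP e.
  rewrite e0 in Vdeg; have v00 : v0 = 0%MM by apply/eqP; rewrite -mdeg_eq0 Vdeg.
  rewrite v00 in Vv0; apply: (lex_exact_degree0 Vv0 Vdeg) pr => //.
  by have := V0alpha _ Vv0; rewrite add0m.
case: e e_gt0 => // e _ in lt Vini Vdeg Vlex pureV bound *.
have ad : (a < d)%N by lia.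
pose i : 'I_d := Ordinal ad.
have g_gt0 : (0 < g)%N.
  suff : (i < a + g)%N by rewrite /=; lia.
  by apply: pureV; [rewrite /=; lia | apply: (@lex_initial_pure _ i b e.+1 V v0) => //=; lia].
(* Either the first variable divides all of [V] and is stripped, or some [v1] avoids it, which
   forces [w0] into [V]. *)
have [[v1 [Vv1 v1i]]|noV'] := pselect (exists v, V v /\ v i = 0%N); last first.
  have Vi v : V v -> (0 < v i)%N.
    by move=> Vv; rewrite lt0n; apply/eqP => vi; apply: noV'; exists v.
  have [r v0E] := mnm_split (Vi _ Vv0).
  (* The new [g] is the trivial bound [b - a]: lowering the degree by one frees [b - a - 1], and the
     old [g] was at least 1. *)
  apply: (IH a b e [set v | V (U_(i) + v)%MM] N (b - a)%N (U_(i) + alpha)%MM beta r U W) => //.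
  - lia.
  - by apply: (@lex_initial_strip _ i b e V) => //=; lia.
  - by rewrite /= -v0E.
  - move=> j ja; rewrite mnmDE mnm1E alpha0 // addn0; apply/eqP.
    by rewrite eqb0; apply/eqP => ij; move: ja; rewrite -ij /= ltnn.
  - by move=> v /V0alpha; rewrite addmA (addmC v).
  - by move=> j; lia.
  - by nia.
  exact: (@presents_strip _ _ _ i).
have Vini' : lex_initial i.+1 b e.+1 (V `&` [set v | v i = 0%N]).
  exact: lex_initial_restrict_l.
have ab' : (a.+1 < b)%N.
  have [j v1j] : exists j, (0 < v1 j)%N by apply: mdeg_gt0P; rewrite Vdeg.
  by have [_ /(_ _ (conj Vv1 v1i) j v1j)] := Vini'; rewrite /=; lia.
have ld : (b.-1 < d)%N by lia.
pose l : 'I_d := Ordinal ld.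
have bE : b = l.+1 by rewrite /=; lia.
have il : (i < l)%N by rewrite /=; lia.
rewrite bE in Vini Vini' Vab pr.
have iab : (i <= i < l.+1)%N by rewrite /=; lia.
pose w0 : 'X_{1..d} := (U_(i) + U_(l) *+ e)%MM.
have Vw0 : V w0.
  apply: (@lex_initial_above _ i l.+1 e.+1 V v1 w0 Vini Vv1).
  - apply: (withinD _ _ _ _).2; split; last by apply: within_mulU; lia.
    by have := @within_mulU _ i l.+1 i 1 iab; rewrite mulm1n.
  - by rewrite mdegD mdegMn !mdeg1 mul1n.
  by rewrite v1i mnmDE mnm1E eqxx.
(* The elements of [V] free of the first variable form a nonempty lex segment, which contains the
   pure power of the second variable. *)
have g_gt1 : (1 < g)%N.
  have a1d : (a.+1 < d)%N by lia.
  suff : (Ordinal a1d < a + g)%N by rewrite /=; lia.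
  apply: pureV; first by rewrite /=; lia.
  have a1l : (Ordinal a1d < l.+1)%N by rewrite /=; lia.
  by have [] := @lex_initial_pure _ _ _ _ _ v1 a1l Vini' (conj Vv1 v1i).
(* With [b - a = c + 2] and [g >= 2] the bound yields [c e + e <= N + c], and [c <= c e] for
   positive [e]. *)
have eN : (e <= N)%N.
  have [->//|e_gt0] := posnP e.
  have [c mE] : exists c, (b - a)%N = c.+2 by exists (b - a - 2)%N; lia.
  by have := leq_pmulr c e_gt0; move: bound; rewrite mE /= (mulSn c) (mulnS c); lia.
apply: (lex_exact_layers il Vw0 (V0alpha _ Vw0) stU stW WU pr eN).
  move=> c ce; have prc := layer_presents il Vini alpha0 (V0alpha _ Vw0) stW pr eN ce.
  (* The last variable is removed and [g] is kept: the left side of the bound drops by [e + 1], the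
     right side by [c + 2], and [c < e]. *)
  apply: (IH _ _ e.+1 _ _ g _ _ (U_(i) *+ e.+1)%MM _ _ _ _ _ _ _ _ _ _ _ _ _ prc).
  - by rewrite /=; lia.
  - by rewrite /=; lia.
  - exact: lex_initial_restrict_r.
  - split; first by apply: (@lex_initial_pure _ i l.+1 e.+1 V v0) => //=; lia.
    by rewrite /= mulmnE mnm1E; case: eqP => // il'; move: il; rewrite il' ltnn.
  - exact: alpha0.
  - by move=> v [/V0alpha].
  - by move=> j jl [Vj _]; apply: pureV => //; move: jl; rewrite /=; lia.
  - by rewrite /=; nia.
  - by apply: stable_layer => //; apply: stable_quot.
  - by apply: stable_layer => //; apply: stable_quot.
  move=> n m [Qm|[Um cm]]; [by left | right; split=> //].
  by apply: leq_trans cm; rewrite leq_add2r.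
have prQ := last_layer_presents il Vini alpha0 (V0alpha _ Vw0) stW pr eN.
(* The first variable is removed, so [g] drops too; both sides of the bound drop by exactly
   [e + 2]. *)
apply: (IH _ _ e.+1 _ _ g.-1 _ _ v1 _ _ _ _ _ _ _ _ _ _ _ _ _ prQ).
- by rewrite /=; lia.
- by rewrite /=; lia.
- exact: Vini'.
- by [].
- by move=> j; rewrite /= => aj; apply: alpha0; lia.
- by move=> v [/V0alpha].
- move=> j jl [Vj _]; have : (j < a + g)%N.
    by apply: pureV => //; move: jl; rewrite /=; lia.
  by rewrite /=; lia.
- by rewrite /=; nia.
- by apply: stable_layer => //; apply: stable_quot.
- exact: stable_quot.
by move=> n m; left.
Qed.

End LexExactness.

(** * Ideals, heights and reductions *)

Section IdealArithmetic.
Variable A : comNzRingType.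
Implicit Types (I J K G P : set A).

Lemma ideal_span_sub G I : is_ideal I -> G `<=` I -> ideal_span G `<=` I.
Proof. by move=> idI GI a; apply. Qed.

Lemma sub_ideal_span G : G `<=` ideal_span G.
Proof. by move=> a Ga I [_ GI]; apply: GI. Qed.

Lemma ideal_mul_sum I K a : is_ideal K -> ideal_mul I K a ->
  exists2 ps : seq (A * A), a = \sum_(p <- ps) p.1 * p.2 &
    forall p : A * A, p \in ps -> K p.1 /\ I p.2.
Proof.
move=> [_ _ KM] aIK; pose S : set A := [set x | exists2 ps : seq (A * A),
  x = \sum_(p <- ps) p.1 * p.2 & forall p : A * A, p \in ps -> K p.1 /\ I p.2].
apply: (aIK S); split; last first.
  move=> _ [x Ix [y Ky <-]]; exists [:: (y, x)]; first by rewrite big_seq1 mulrC.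
  by move=> p; rewrite inE => /eqP ->.
split=> [|_ _ [ps -> psP] [qs -> qsP]|r _ [ps -> psP]].
- by exists [::]; rewrite ?big_nil.
- exists (ps ++ qs); first by rewrite big_cat.
  by move=> p; rewrite mem_cat => /orP[/psP|/qsP].
exists [seq (r * p.1, p.2) | p <- ps].
  by rewrite big_map mulr_sumr; apply: eq_bigr => p _; rewrite mulrA.
by move=> _ /mapP[p /psP[Kp Ip] ->]; split=> //; apply: KM.
Qed.

Lemma ideal_exp_ideal I n : is_ideal (ideal_exp I n).
Proof.
case: n => [|n]; first by [].
split=> [|a b Ia Ib|a b Ib] P [idP PI]; have [P0 PD PM] := idP => //.
  by apply: PD; [apply: Ia | apply: Ib].
by apply: PM; apply: Ib.
Qed.

Lemma ideal_expX I a n : I a -> ideal_exp I n (a ^+ n).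
Proof.
move=> Ia; elim: n => [//|n IH]; apply: sub_ideal_span.
by rewrite exprS; exists a => //; exists (a ^+ n).
Qed.

Lemma prime_ideal_exp P a n : is_prime_ideal P -> P (a ^+ n) -> P a.
Proof.
move=> [_ P1 PM]; elim: n => [//|n IH].
by rewrite exprS => /PM[].
Qed.

End IdealArithmetic.

(** * Primes generated by variables *)

Section CoordinatePrimes.
Variables (k : fieldType) (d : nat).
Implicit Types (p q : {mpoly k[d]}) (m : 'X_{1..d}) (n : nat).

Definition touches n : set 'X_{1..d} :=
  [set m | exists2 j : 'I_d, (j < n)%N & (0 < m j)%N].

Let kill n : d.-tuple {mpoly k[d]} :=
  [tuple (if (j < n)%N then 0 else 'X_j : {mpoly k[d]}) | j < d].

Let kill_touches n m : touches n m -> 'X_[m] \mPo kill n = 0.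
Proof.
move=> [j jn mj]; rewrite comp_mpolyX (bigD1 j) //= tnth_mktuple jn.
by rewrite expr0n eqn0Ngt mj mul0r.
Qed.

Let kill_untouched n m : ~ touches n m -> 'X_[m] \mPo kill n = 'X_[m].
Proof.
move=> tm; rewrite comp_mpolyX [RHS]mpolyXE_id; apply: eq_bigr => j _.
rewrite tnth_mktuple; case: ifP => // jn.
have -> : m j = 0%N by case: (posnP (m j)) => // mj; case: tm; exists j.
by rewrite !expr0.
Qed.

(** The ideal of the first [n] variables is the kernel of setting them to zero; it is therefore
    prime, as polynomials form a domain. *)
Lemma mspan_touchesE n p : mspan (touches n) p <-> p \mPo kill n = 0.
Proof.
split=> [pn|p0 m mp].
  rewrite comp_mpolyEX big_seq big1 // => m /pn /kill_touches ->.
  by rewrite scaler0.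
apply: contrapT => tm; move: mp; rewrite mcoeff_msupp => /eqP; apply.
have /(congr1 (mcoeff m)) := p0; rewrite mcoeff0 => <-.
rewrite {1}[p]mpolyE comp_mpolyEX !raddf_sum /=; apply: eq_bigr => m' _.
rewrite !mcoeffZ; have [tm'|tm'] := pselect (touches n m').
  rewrite kill_touches // mcoeff0 mcoeffX; case: eqP => // m'm.
  by case: tm; rewrite -m'm.
by rewrite kill_untouched.
Qed.

Lemma upclosed_touches n : upclosed (touches n).
Proof.
by move=> m m' [j jn mj]; exists j; rewrite // mnmDE addn_gt0 mj orbT.
Qed.

Lemma prime_touches n : is_prime_ideal (mspan (k := k) (touches n)).
Proof.
split; first exact/mspan_ideal/upclosed_touches.
  by move=> /(_ 0%MM); rewrite msupp1 mem_head => /(_ isT)[j]; rewrite mnm0E.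
move=> p q /mspan_touchesE; rewrite rmorphM => /eqP.
by rewrite mulf_eq0 => /orP[] /eqP /mspan_touchesE; [left | right].
Qed.

(** The chain consists of the ideals of the first 0, 1, ..., [n] variables, followed by [P]
    itself. *)
Lemma prime_height_ge_variables (P : set {mpoly k[d]}) n : (n < d)%N ->
  is_prime_ideal P -> (forall j : 'I_d, (j <= n)%N -> P 'X_j) ->
  prime_height_ge P n.+1.
Proof.
move=> nd primeP PX; have [[P0 PD PM] _ _] := primeP.
have PC i : (i <= n.+1)%N -> mspan (touches i) `<=` P.
  move=> lein p pn; rewrite [p]mpolyE big_seq; elim/big_ind: _ => // m /pn[j ji mj].
  have -> : 'X_[m] = 'X_[m - U_(j)] * 'X_j :> {mpoly k[d]}.
    by rewrite -mpolyXD submK // lep1mP -lt0n.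
  by rewrite -mul_mpolyC mulrA; apply: PM; apply: PX; lia.
exists (fun i => if (i <= n)%N then mspan (touches i) else P); split=> [i _|i lein|].
- by case: ifP => // _; apply: prime_touches.
- have id' : (i < d)%N by lia.
  have XC : ~ mspan (touches i) ('X_(Ordinal id') : {mpoly k[d]}).
    move=> /(_ U_(Ordinal id')%MM); rewrite msuppX mem_head => /(_ isT)[j ji].
    by rewrite mnm1E; case: eqP => // e1; move: ji; rewrite -e1 /= ltnn.
  have -> : (i <= n)%N by lia.
  case: ifP => lein'; split.
  + by apply: mspanS => m [j ji mj]; exists j => //; lia.
  + move=> /(_ 'X_(Ordinal id')) sub; apply: XC; apply: sub; apply: mspanX.
    by exists (Ordinal id'); rewrite //= mnm1E eqxx.
  + by apply: PC; lia.
  by move=> /(_ 'X_(Ordinal id')) sub; apply: XC; apply: sub; apply: PX => /=; lia.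
by rewrite ltnn.
Qed.

End CoordinatePrimes.

(** * Lex segments, heights and reductions *)

Section LexSegments.
Variables (k : fieldType) (d : nat).
Implicit Types (L J : set {mpoly k[d]}) (V : set 'X_{1..d}) (m v : 'X_{1..d}).

Lemma within_full m : within 0 d m.
Proof. by move=> j _; rewrite ltn_ord. Qed.

Lemma mem_lex_monomials e m : (m \in lex_monomials d e) = (mdeg m == e).
Proof.
rewrite mem_sort mem_filter andb_idr // => /eqP me.
have mb : (mdeg m < e.+1)%N by rewrite me.
by apply/mapP; exists (BMultinom mb) => //; rewrite mem_enum.
Qed.

Lemma take_lex_monomials e c :
  lex_initial 0 d e [set m | m \in take c (lex_monomials d e)].
Proof.
split=> [v /mem_take|v _|v m vc _ me vm].
- by rewrite mem_lex_monomials => /eqP.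
- exact: within_full.
apply: contrapT => mc.
have : m \in drop c (lex_monomials d e).
  have : m \in take c (lex_monomials d e) ++ drop c (lex_monomials d e).
    by rewrite cat_take_drop mem_lex_monomials me.
  by rewrite mem_cat => /orP[/mc|].
have: pairwise (fun m m' : 'X_{1..d} => (m' <= m)%O) (lex_monomials d e).
  rewrite -sorted_pairwise; first by apply: sort_sorted => x y; apply: le_total.
  by move=> x y z /= yx zx; apply: le_trans zx yx.
rewrite -{1}[lex_monomials d e](cat_take_drop c) pairwise_cat => /andP[/allrelP le_mv _].
move=> /(le_mv _ _ vc); rewrite leNgt => /negP; apply.
have ve : mdeg v = e by have := mem_take vc; rewrite mem_lex_monomials => /eqP.
by apply/ltmcP; [rewrite ve | case: vm => i vm vmi; exists i => // j /vm].
Qed.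

Lemma mspan_ideal_exp L V n : L `<=` mspan (mpow V setT 1) ->
  ideal_exp L n `<=` mspan (mpow V setT n).
Proof.
move=> LV; elim: n => [|n IH]; first by move=> p _ m.
apply: ideal_span_sub.
  apply: mspan_ideal => m m'; apply: (mpow_add (Y := setT)); by [].
move=> _ [p /LV pV [q /IH qV <-]]; apply: mspanM pV qV => m m'.
move=> [v [z [Vv _ ->]]] Mm'; exists v, (z + m')%MM.
by split=> //; [apply: (mpow_add (Y := setT)) Mm' | rewrite addmA].
Qed.

Lemma mspan_maximal_ideal_exp n :
  ideal_exp (maximal_homogeneous_ideal k d) n `<=`
  mspan [set m | (n <= mdeg m)%N].
Proof.
have deg_up i : upclosed [set m : 'X_{1..d} | (i <= mdeg m)%N].
  by move=> m m' /=; rewrite mdegD => im; apply: leq_trans im (leq_addl _ _).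
elim: n => [|n IH]; first by move=> p _ m.
apply: ideal_span_sub; first exact/mspan_ideal/deg_up.
have mS : maximal_homogeneous_ideal k d `<=` mspan [set m | (1 <= mdeg m)%N].
  apply: ideal_span_sub; first exact/mspan_ideal/deg_up.
  by move=> _ [j _ <-]; apply: mspanX; rewrite /= mdeg1.
move=> _ [p /mS pS [q /IH qS <-]]; apply: mspanM pS qS => m m' /= m1 nm'.
by rewrite mdegD; lia.
Qed.

Lemma mem_lin_span (s : seq {mpoly k[d]}) p : p \in s -> lin_span s p.
Proof.
move=> ps; have ip : (index p s < size s)%N by rewrite index_mem.
exists (fun i => (i == Ordinal ip)%:R).
rewrite (bigD1 (Ordinal ip)) //= eqxx scale1r nth_index // big1 ?addr0 // => j.
by move=> /negPf ->; rewrite scale0r.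
Qed.

Lemma lin_span_ideal (s : seq {mpoly k[d]}) (I : set {mpoly k[d]}) :
  is_ideal I -> (forall p, p \in s -> I p) -> lin_span s `<=` I.
Proof.
move=> [I0 ID IM] sI _ [a ->]; elim/big_ind: _ => // j _.
by rewrite -mul_mpolyC; apply: IM; apply/sI/mem_nth.
Qed.

(** The power [N + 1] of each monomial lies in [L^(N+1) = J L^N]; the finitely many factors from [J]
    in such expressions make up [fs]. *)
Lemma reduction_generators L J V (vs : seq 'X_{1..d}) :
  is_reduction L J -> L `<=` mspan (mpow V setT 1) ->
  (forall v, v \in vs -> L 'X_[v]) ->
  exists2 fs : seq {mpoly k[d]}, forall f, f \in fs -> J f &
    forall v, v \in vs -> exists j,
      exists2 ps : seq ({mpoly k[d]} * {mpoly k[d]}),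
        'X_[v] ^+ j.+1 = \sum_(p <- ps) p.1 * p.2 &
        forall p : {mpoly k[d]} * {mpoly k[d]}, p \in ps ->
          p.2 \in fs /\ mspan (mpow V setT j) p.1.
Proof.
move=> [_ _ [N redN]] LV; elim: vs => [|v vs IH] Lvs; first by exists [::].
have [w wvs|fs fsJ fsP] := IH; first by apply: Lvs; rewrite inE wvs orbT.
have : ideal_mul J (ideal_exp L N) ('X_[v] ^+ N.+1).
  by rewrite -redN //; apply: ideal_expX; apply: Lvs; rewrite mem_head.
move=> /(ideal_mul_sum (ideal_exp_ideal L N))[ps psE psP].
exists ([seq p.2 | p <- ps] ++ fs) => [f|w].
  by rewrite mem_cat => /orP[/mapP[p /psP[_ Jp] ->]|/fsJ].
rewrite inE => /predU1P[->|/fsP[j [qs qsE qsP]]].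
  exists N, ps => // p pps; split; last by apply: (mspan_ideal_exp LV); case: (psP p).
  by rewrite mem_cat map_f.
by exists j, qs => // p /qsP[pfs ?]; rewrite mem_cat pfs orbT.
Qed.

(** If [g <= i], the segment contains the pure powers of [x_0, ..., x_g]. Every prime over [L] then
    contains these [g + 1] variables, so its height exceeds [g]. *)
Lemma lex_segment_height L g e V (i : 'I_d) :
  (0 < e)%N -> has_height L g -> lex_initial 0 d e V ->
  (forall v, V v -> L 'X_[v]) -> V (U_(i) *+ e)%MM -> (i < g)%N.
Proof.
move=> e_gt0 [[P [primeP LP [_ nheight]]] _] [_ _ Vlex] VL Vi.
rewrite ltnNge; apply/negP => gi; apply: nheight.
have gd : (g < d)%N by apply: leq_ltn_trans gi (ltn_ord i).
apply: prime_height_ge_variables => // j jg.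
apply: (prime_ideal_exp (n := e)) primeP _; rewrite mpolyXn; apply/LP/VL.
have [->//|ji] := eqVneq j i.
apply: (Vlex _ _ Vi); first exact: within_full.
  by rewrite mdegMn mdeg1 mul1n.
have jli : (j < i)%N.
  by rewrite ltn_neqAle (leq_trans jg gi) andbT; apply: contra_neq ji; apply: val_inj.
have neq (x y : 'I_d) : (x < y)%N -> (y == x) = false.
  by move=> xy; apply/eqP => yx; move: xy; rewrite yx ltnn.
exists j => [j' j'j|]; rewrite !mulmnE !mnm1E.
  by rewrite !neq // (ltn_trans j'j).
by rewrite eqxx neq // mul0n mul1n.
Qed.

End LexSegments.


Theorem theorem6p9 (k : fieldType) (d g delta : nat) (L : set {mpoly k[d]})
    (infinite_k : infinite_set [set: k])
    (lex_L : lex_segment_ideal L)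
    (height_L : has_height L g) (g_ge2 : (2 <= g)%N)
    (degree_L : generated_in_degree L delta) (delta_ge2 : (2 <= delta)%N) :
  ideal_mul L (ideal_exp (maximal_homogeneous_ideal k d)
                         (d * (delta - 2) + g - delta + 1)%N)
    `<=` core L.
Proof.
move=> p pLm J redJ; have [idJ JL _] := redJ.
have [_ /(_ delta)[c _ degreeE]] := lex_L.
pose vs := take c (lex_monomials d delta).
pose V : set 'X_{1..d} := [set m | m \in vs].
have Vini : lex_initial 0 d delta V by apply: take_lex_monomials.
have VL v : V v -> L 'X_[v].
  move=> vV; suff : graded_part L delta 'X_[v] by case.
  by rewrite degreeE; apply: mem_lin_span; apply: map_f.
have LV : L `<=` mspan (mpow V setT 1).
  have idV : is_ideal (mspan (k := k) (mpow V setT 1)).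
    by apply: mspan_ideal => m m'; apply: (mpow_add (Y := setT)).
  rewrite degree_L degreeE; apply: ideal_span_sub => //.
  apply: lin_span_ideal => // _ /mapP[v vV ->]; apply: mspanX.
  by exists v, 0%MM; rewrite addm0.
set N := (d * (delta - 2) + g - delta + 1)%N in pLm.
pose U := mpow V (large_within 0 d N).
have upU n : upclosed (U n).
  move=> m m'; apply: (mpow_large_add (N := N)); last by rewrite leq_addr.
  exact: within_full.
have pU : mspan (U 1%N) p.
  apply: pLm; split; first exact: mspan_ideal.
  move=> _ [a /LV aV [b /mspan_maximal_ideal_exp bN <-]].
  apply: mspanM aV bN => m m' [v [z [Vv _ ->]]] m'N; exists v, (z + m')%MM.
  split=> //; last by rewrite addmA.
  split; first exact: within_full.
  by rewrite /= mdegD; apply: leq_trans m'N (leq_addl _ _).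
have [V_empty|/existsNP[v0 /contrapT Vv0]] := pselect (forall v, ~ V v).
  suff -> : p = 0 by case: idJ.
  apply/mpolyP => m; rewrite mcoeff0; apply: memN_msupp_eq0.
  by apply/negP => /pU[v [z [/V_empty]]].
have [v0deg _ _] := Vini.
have d_gt0 : (0 < d)%N.
  have [|j _] := @mdeg_gt0P d v0; first by rewrite (v0deg _ Vv0); lia.
  exact: leq_ltn_trans (ltn_ord j).
have [fs fsJ fsnil] := reduction_generators redJ LV VL.
have stU : stable V U by split=> // n v m Vv Um; exists v, m.
(* [U n] holds the monomials of [L^n] times the [N]-th power of the maximal ideal; the induction
   starts with all variables and no shift. *)
have exU : mono_exact fs U (fun=> set0).
  apply: (@lex_exact _ _ fs V _ _ (d - 0 + delta)%N 0 d delta V N g 0%MM 0%MM v0) => //.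
  - by move=> f /fsJ /JL /LV.
  - by rewrite d_gt0 leqnn.
  - by move=> j _; rewrite mnm0E.
  - by move=> v; rewrite addm0.
  - move=> j _; apply: (lex_segment_height _ height_L Vini VL).
    exact: ltnW.
  (* With [d = d' + 1] and [delta = e + 2], [N] is at least [d' e + g - 1]. *)
  - rewrite /N; case: (d) d_gt0 => // d' _; case: (delta) delta_ge2 => [|[|e]] // _.
    by rewrite /= subn0; nia.
  - by split=> [n m m' []|n v m _ []].
  - by move=> n m [].
  split=> [n m|z Yz|m j _]; last by rewrite mnm0E.
    split=> [[Um _]|[z Mz ->]].
      by exists m => //; apply/mnmP => j; rewrite !mnmDE mulmnE !mnm0E; lia.
    split=> //; suff -> : (z + 0 *+ n.+1 + 0)%MM = z by [].
    by apply/mnmP => j; rewrite !mnmDE mulmnE !mnm0E; lia.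
  by rewrite addm0.
apply: (koszul_exact_ideal idJ fsJ _ _ _ exU pU).
- exact: mspan_ideal.
- exact: mspan_ideal.
move=> q q0; apply/mpolyP => m; rewrite mcoeff0; apply: memN_msupp_eq0.
by apply/negP => /q0.
Qed.
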